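(* If $\delta$ is a fuzzy topology on a set $X$, then $\iota(\delta)$ is a topology on $X$ such that $\delta\subset\omega(\iota(\delta))$, with equality if and only if $\delta$ is affine invariant. Thus, if $\tau=\iota(\delta)$, then $\delta\subset\omega(\tau)$.
   Context: Let $I=[0,1]\subset\mathbb{R}$, and for a set $X$ let $I^X$ be the set of all functions $X\to I$, with pointwise suprema $\bigvee$ and infima $\bigwedge$. All index sets are assumed nonempty. A subset $\delta\subset I^X$ is a fuzzy topology on $X$ if: (i) the constant functions $0,1$ are in $\delta$; (ii) $\bigvee_{i\in K} f_i\in\delta$ for every indexed family $\{f_i:i\in K\}$ in $\delta$; (iii) $\bigwedge_{i\in K} f_i\in\delta$ for every finite indexed family $\{f_i : i\in K\}$ in $\delta$. It is affine invariant if (ii) and (iii) hold and (i) is replaced by: (i'') the constant function $0$ is in $\delta$, and whenever $f\in\delta$, $m,k\in\mathbb{R}$ with $m>0$, and $g=m\cdot f+k$ satisfies $g(x)\in I$ for all $x\in X$, then $g\in\delta$ (this implies (i)). For $f:X\to\mathbb{R}$ and $c\in\mathbb{R}$ write $f_{(c}=f^{-1}(c,\infty)$. For a topology $\tau$ on $X$, $\omega(\tau)=\{f\in I^X : f_{(c}\in\tau \text{ for all } c\in I\}$, the set of lower semicontinuous functions from $(X,\tau)$ to $I$. For a fuzzy topology $\delta$ on $X$, $\iota(\delta)$ is the coarsest topology on $X$ containing all the sets $f_{(c}$ with $c\in I$, $f\in\delta$ (i.e. it has these sets as a subbase). *)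

(* Defs.v *)
From mathcomp Require Import all_boot all_order all_algebra.
From mathcomp Require Import all_classical all_reals all_analysis.

Set Implicit Arguments.
Unset Strict Implicit.
Unset Printing Implicit Defensive.

Import Order.TTheory GRing.Theory Num.Theory.

Local Open Scope classical_set_scope.
Local Open Scope ring_scope.

(* Fuzzy sets on X are represented as functions f : X -> R satisfying
   unit_valued f; the type X is arbitrary (possibly empty). *)
Definition unit_valued (R : realType) (X : Type) : set (X -> R) :=
  [set f | forall x, `[0, 1]%classic (f x)].

(* sup and inf are the real-valued ones, which are only meaningful on nonempty
   bounded sets: below they are applied to nonempty families in unit_valued. *)
Definition fun_sup (R : realType) (X K : Type) (f : K -> X -> R) : X -> R :=
  fun x => sup (range (fun i => f i x)).

Definition fun_inf (R : realType) (X K : Type) (f : K -> X -> R) : X -> R :=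
  fun x => inf (range (fun i => f i x)).

Definition fun_sup_closed (R : realType) (X : Type) (delta : set (X -> R)) :=
  forall (K : Type) (f : K -> X -> R),
    inhabited K -> (forall i, delta (f i)) -> delta (fun_sup f).

Definition fun_fininf_closed (R : realType) (X : Type)
    (delta : set (X -> R)) :=
  forall (K : finType) (f : K -> X -> R),
    inhabited K -> (forall i, delta (f i)) -> delta (fun_inf f).

Definition fuzzy_topology (R : realType) (X : Type) (delta : set (X -> R)) :=
  [/\ delta `<=` @unit_valued R X,
      delta (fun=> 0) /\ delta (fun=> 1),
      fun_sup_closed delta &
      fun_fininf_closed delta].

Definition affine_closed (R : realType) (X : Type) (delta : set (X -> R)) :=
  forall (f : X -> R) (m k : R),
    delta f -> 0 < m -> unit_valued (fun x => m * f x + k) ->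
    delta (fun x => m * f x + k).

Definition affine_invariant (R : realType) (X : Type)
    (delta : set (X -> R)) :=
  [/\ delta `<=` @unit_valued R X,
      delta (fun=> 0) /\ affine_closed delta,
      fun_sup_closed delta &
      fun_fininf_closed delta].

(* Topologies on a fixed X are compared as families of open sets, so they are
   predicates here rather than topologicalType structures on X. *)
Definition is_topology (X : Type) (tau : set (set X)) :=
  [/\ tau set0, tau [set: X],
      forall A B, tau A -> tau B -> tau (A `&` B) &
      forall (K : Type) (F : K -> set X),
        (forall i, tau (F i)) -> tau (\bigcup_i F i)].

Definition superlevel (R : realType) (X : Type) (f : X -> R) (c : R) : set X :=
  f @^-1` `]c, +oo[%classic.

Definition omega (R : realType) (X : Type) (tau : set (set X)) :
    set (X -> R) :=
  [set f | unit_valued f /\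
           forall c, `[0, 1]%classic c -> tau (superlevel f c)].

Definition superlevel_sets (R : realType) (X : Type) (delta : set (X -> R)) :
    set (set X) :=
  [set U | exists f c, [/\ delta f, `[0, 1]%classic c & U = superlevel f c]].

Definition iota_topology (R : realType) (X : Type) (delta : set (X -> R)) :
    set (set X) :=
  smallest (@is_topology X) (superlevel_sets delta).

(* Main.v *)
Require Import Defs.
From mathcomp Require Import all_boot all_order all_algebra.
From mathcomp Require Import all_classical all_reals all_analysis.
From mathcomp Require Import lra.

(** The inclusion [delta <= omega (iota delta)] is immediate, and [omega tau] is
    always affine invariant because [m f + k > c] iff [f > (c - k) / m].
    Conversely, if [delta] is affine invariant, the sets whose indicator lies in
    [delta] form a topology.  It contains every [{f > c}] with [f] in [delta],
    since the indicator of this set is the supremum over [d] in [(c, 1]] of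
    [(min (max f c) d - c) / (d - c)].  Hence it contains [iota delta], and any
    [f] in [omega (iota delta)] is the supremum over [c] in [[0, 1]] of the
    functions [min c (indicator of {f > c})], which all lie in [delta]. *)

Import Order.TTheory GRing.Theory Num.Theory.

Local Open Scope classical_set_scope.
Local Open Scope ring_scope.

Lemma is_topology_smallest (X : Type) (G : set (set X)) :
  is_topology (smallest (@is_topology X) G).
Proof.
split.
- by move=> T [[]].
- by move=> T [[]].
- by move=> A B hA hB T hT; case: (hT) => -[_ _ + _] _; apply; [exact: hA|exact: hB].
- by move=> K F hF T hT; case: (hT) => -[_ _ _ +] _; apply => i; exact: hF.
Qed.

Section SupInfClosed.
Variables (R : realType) (X : Type) (delta : set (X -> R)).

(** A criterion for membership in [delta] that spares later proofs any handling of [sup]: an upper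
    bound that is approximated from below at every point must be the pointwise supremum. *)
Lemma fun_sup_closed_lub (K : Type) (F : K -> X -> R) (h : X -> R) :
  fun_sup_closed delta -> inhabited K -> (forall i, delta (F i)) ->
  (forall i x, F i x <= h x) ->
  (forall x e, e < h x -> exists i, e < F i x) ->
  delta h.
Proof.
move=> supd [k0] dF Fh happrox.
suff -> : h = fun_sup F by apply: supd.
apply/funext => x; rewrite /fun_sup.
have ubh : ubound (range (fun i => F i x)) (h x) by move=> _ [i _ <-].
have ne : range (fun i => F i x) !=set0 by exists (F k0 x), k0.
apply/eqP; rewrite eq_le ge_sup// andbT leNgt; apply/negP => /happrox[i]; apply/negP; rewrite -leNgt.
by apply: ub_le_sup; [exists (h x)|exists i].
Qed.

Lemma fun_sup_closed_max (f g : X -> R) :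
  fun_sup_closed delta -> delta f -> delta g ->
  delta (fun x => Num.max (f x) (g x)).
Proof.
move=> supd df dg.
apply: (@fun_sup_closed_lub bool (fun b : bool => if b then f else g)) => //.
- exact: (inhabits true).
- by case.
- by case=> x; rewrite le_max lexx ?orbT.
- by move=> x e; rewrite lt_max => /orP[?|?]; [exists true|exists false].
Qed.

Lemma fun_fininf_closed_min (f g : X -> R) :
  fun_fininf_closed delta -> delta f -> delta g ->
  delta (fun x => Num.min (f x) (g x)).
Proof.
move=> infd df dg; pose F (b : bool) := if b then f else g.
suff -> : (fun x => Num.min (f x) (g x)) = fun_inf F.
  by apply: infd => [|[]//]; exact: (inhabits true).
apply/funext => x; rewrite /fun_inf.
have lbm : lbound (range (fun b => F b x)) (Num.min (f x) (g x)).
  by move=> _ [[] _ <-]; rewrite /F ge_min lexx ?orbT.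
have ne : range (fun b => F b x) !=set0 by exists (F true x), true.
apply/eqP; rewrite eq_le lb_le_inf//= le_min.
apply/andP; split; apply: ge_inf; try by exists (Num.min (f x) (g x)).
  by exists true.
by exists false.
Qed.

End SupInfClosed.

Lemma sub_omega_iota (R : realType) (X : Type) (delta : set (X -> R)) :
  delta `<=` @unit_valued R X -> delta `<=` @omega R X (iota_topology delta).
Proof.
move=> du f df; split; first exact: du.
by move=> c c01 T [_ +]; apply; exists f, c.
Qed.

Lemma affine_closed_omega (R : realType) (X : Type) (tau : set (set X)) :
  tau set0 -> tau [set: X] -> affine_closed (@omega R X tau).
Proof.
move=> tau0 tauT f m k [f01 ftau] m0 g01; split=> // c _.
have -> : superlevel (fun x => m * f x + k) c = superlevel f ((c - k) / m).
  apply/seteqP; split=> x; rewrite /superlevel /= !in_itv/= !andbT;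
    by rewrite ltr_pdivrMr// (mulrC m) ltrBlDr.
(* The new threshold [c'] may leave [[0, 1]], where [omega] gives no information. Since [f] is unit
   valued, the superlevel set is then everything ([c' < 0]) or empty ([c' > 1]). *)
set c' := (c - k) / m; case: (ltP c' 0) => [c'0|c'0].
  suff -> : superlevel f c' = [set: X] by [].
  apply/seteqP; split=> x // _; rewrite /superlevel /= in_itv/= andbT.
  by have := f01 x; rewrite /= in_itv/= => /andP[fx0 _]; exact: lt_le_trans fx0.
case: (leP c' 1) => [c'1|c'1]; first by apply: ftau; rewrite /= in_itv/= c'0.
suff -> : superlevel f c' = set0 by [].
apply/seteqP; split=> x //; rewrite /superlevel /= in_itv/= andbT ltNge => /negP[].
have := f01 x; rewrite /= in_itv/= => /andP[_ fx1].
exact: le_trans (ltW c'1).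
Qed.

Section AffineInvariant.
Variables (R : realType) (X : Type) (delta : set (X -> R)).
Hypothesis deltaP : affine_invariant delta.

Lemma affine_invariant_cst (c : R) : 0 <= c <= 1 -> delta (fun=> c).
Proof.
case: deltaP => _ [d0 daff] _ _ c01.
(* The slope must be positive, so the constant is a translate of 0 with slope 1. *)
have -> : (fun=> c) = (fun x : X => 1 * 0 + c) by apply/funext => x; rewrite mulr0 add0r.
by apply: daff => // x; rewrite mulr0 add0r /= in_itv.
Qed.

Lemma affine_invariant_indic_superlevel (f : X -> R) (c : R) :
  delta f -> 0 <= c <= 1 -> delta \1_(superlevel f c).
Proof.
case: deltaP => du [d0 daff] dsup dinf df /andP[c0 c1].
have f01 x : 0 <= f x <= 1 by have := du _ df x; rewrite /= in_itv.
(* For [c = 1] there is no [d] with [c < d <= 1], so the family below would be empty; the indicator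
   is then 0. *)
have [->|cn1] := eqVneq c 1.
  suff -> : \1_(superlevel f 1) = (fun=> 0) :> (X -> R) by [].
  apply/funext => x; rewrite indicE memNset// /superlevel /= in_itv/= andbT.
  by apply/negP; rewrite -leNgt; case/andP: (f01 x).
have {}c1 : c < 1 by rewrite lt_neqAle cn1.
(* Truncate [f] to [[c, d]] and rescale to [[0, 1]]. The shape [m * g + k] matches [affine_closed];
   [FE] restores the quotient. *)
pose F (d : {d : R | c < d <= 1}) (x : X) :=
  (sval d - c)^-1 * Num.min (Num.max (f x) c) (sval d) + - c / (sval d - c).
have FE d x : F d x = (Num.min (Num.max (f x) c) (sval d) - c) / (sval d - c).
  by rewrite /F mulrC mulrDl.
have F01 d x : 0 <= F d x <= 1.
  case: d (FE d x) => d /= /andP[cd d1] ->.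
  have dc : 0 < d - c by rewrite subr_gt0.
  rewrite divr_ge0 ?(ltW dc)//=; last by rewrite subr_ge0 le_min le_max lexx orbT ltW.
  by rewrite ler_pdivrMr// mul1r lerB// ge_min lexx orbT.
apply: (@fun_sup_closed_lub _ _ _ _ F) => //.
- by apply: inhabits; exists 1; rewrite c1 lexx.
- move=> d; apply: daff.
  + apply: fun_fininf_closed_min => //.
      by apply: fun_sup_closed_max => //; apply: affine_invariant_cst; rewrite c0 ltW.
    case: d => d /= /andP[cd d1]; apply: affine_invariant_cst.
    by rewrite d1 (le_trans c0)// ltW.
  + by case: d => d /= /andP[cd d1]; rewrite invr_gt0 subr_gt0.
  + by move=> x; rewrite /= in_itv; exact: F01.
- move=> d x; rewrite indicE; case: (ltP c (f x)) => cfx.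
    by rewrite mem_set /superlevel /= ?in_itv/= ?cfx//; case/andP: (F01 d x).
  rewrite FE (max_idPr cfx); case: d => d /= /andP[cd _].
  by rewrite (min_idPl (ltW cd)) subrr mul0r ler0n.
(* Where [f x > c], the index [d = f x] attains the value 1. Elsewhere [e < 0], so any index works,
   for instance [d = 1]. *)
- move=> x e; rewrite indicE; case: (ltP c (f x)) => cfx.
    rewrite mem_set /superlevel /= ?in_itv/= ?cfx// => e1.
    have cf1 : c < f x <= 1 by rewrite cfx; case/andP: (f01 x).
    exists (exist _ (f x) cf1); rewrite FE /= (max_idPl (ltW cfx)) minxx divff//.
    by rewrite subr_eq0 gt_eqF.
  rewrite memNset; last by rewrite /superlevel /= in_itv/= andbT => /lt_geF; rewrite cfx.
  move=> e0; have c11 : c < 1 <= (1 : R) by rewrite c1 lexx.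
  by exists (exist _ 1 c11); apply: lt_le_trans e0 _; case/andP: (F01 (exist _ 1 c11) x).
Qed.

(** Indicators turn intersections into minima and unions into suprema, under which [delta] is
    closed. *)
Lemma is_topology_indic : is_topology [set U | delta \1_U].
Proof.
case: deltaP => du [d0 daff] dsup dinf; split=> /=.
- suff -> : \1_set0 = (fun=> 0) :> (X -> R) by [].
  by apply/funext => x; rewrite indicE in_set0.
- suff -> : \1_setT = (fun=> 1) :> (X -> R).
    by apply: affine_invariant_cst; rewrite ler01 lexx.
  by apply/funext => x; rewrite indicE in_setT.
- move=> A B dA dB.
  suff -> : \1_(A `&` B) = (fun x => Num.min (\1_A x) (\1_B x)) :> (X -> R).
    exact: fun_fininf_closed_min.
  apply/funext => x; rewrite !indicE in_setI.
  by case: (x \in A); case: (x \in B); rewrite /= ?minxx ?(min_idPl ler01) ?(min_idPr ler01).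
- move=> K F dF.
  (* [fun_sup_closed] needs a nonempty family: adjoin [set0] to the [F i]. *)
  pose G (o : option K) : X -> R := if o is Some i then \1_(F i) else (fun=> 0).
  apply: (@fun_sup_closed_lub _ _ _ _ G) => //.
  + exact: (inhabits None).
  + by case.
  + case=> [i|] x; rewrite /G !indicE ?ler0n// ler_nat.
    case: (boolP (x \in F i)) => //; rewrite inE => Fix.
    by rewrite mem_set//; exists i.
  + move=> x e; rewrite indicE; case: (boolP (x \in _)) => [|_ e0]; last by exists None.
    by rewrite inE => -[i _ Fix] e1; exists (Some i); rewrite /G indicE mem_set.
Qed.

Lemma omega_iota_sub : @omega R X (iota_topology delta) `<=` delta.
Proof.
case: (deltaP) => du [d0 daff] dsup dinf f [fu fiota].
have f01 x : 0 <= f x <= 1 by have := fu x; rewrite /= in_itv.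
pose F (c : {c : R | 0 <= c <= 1}) (x : X) : R :=
  Num.min (sval c) (\1_(superlevel f (sval c)) x).
apply: (@fun_sup_closed_lub _ _ _ _ F) => //.
- by apply: inhabits; exists 0; rewrite lexx ler01.
- case=> c c01; apply: fun_fininf_closed_min => //=; first exact: affine_invariant_cst.
  (* Membership in [iota_topology delta] is tested on the topology of sets with indicator in
     [delta], which contains every generator. *)
  have := fiota c; rewrite /= in_itv => /(_ c01); move=> /(_ [set U | delta \1_U]); apply; split.
    exact: is_topology_indic.
  move=> _ [g [d [dg + ->]]]; rewrite /= in_itv => d01.
  exact: affine_invariant_indic_superlevel.
- case=> c c01 x; rewrite /F /= indicE ge_min.
  case: (ltP c (f x)) => [/ltW->//|fxc].
  rewrite memNset; first by apply/orP; right; case/andP: (f01 x).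
  by rewrite /superlevel /= in_itv/= andbT => /lt_geF; rewrite fxc.
- move=> x e efx; have /andP[fx0 fx1] := f01 x.
  have [e0|e0] := ltP e 0.
    have z01 : 0 <= (0 : R) <= 1 by rewrite lexx ler01.
    by exists (exist _ 0 z01); rewrite /F /= lt_min e0 (lt_le_trans e0)// indicE ler0n.
  (* Any [c] strictly between [e] and [f x] works: the indicator at [x] is then 1, and both [c] and
     1 exceed [e]. *)
  pose c := (e + f x) / 2.
  have ec : e < c by rewrite /c; lra.
  have cf : c < f x by rewrite /c; lra.
  have c01 : 0 <= c <= 1 by apply/andP; split; lra.
  exists (exist _ c c01); rewrite /F /= lt_min ec indicE mem_set; first by rewrite (lt_le_trans efx).
  by rewrite /superlevel /= in_itv/= cf.
Qed.

End AffineInvariant.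

Local Close Scope ring_scope.

Theorem theorem1p4 (R : realType) (X : Type) (delta : set (X -> R))
    (hdelta : fuzzy_topology delta) :
  [/\ is_topology (iota_topology delta),
      delta `<=` @omega R X (iota_topology delta),
      delta = @omega R X (iota_topology delta) <-> affine_invariant delta &
      forall tau : set (set X),
        tau = iota_topology delta -> delta `<=` @omega R X tau].
Proof.
have topi : is_topology (iota_topology delta) by exact: is_topology_smallest.
case: (hdelta) => du [d0 d1] dsup dinf.
have sub := @sub_omega_iota R X delta du.
split=> //; last by move=> _ ->.
split=> [deltaE|deltaP].
(* Only affine closedness remains beyond the fuzzy topology axioms; it is transported from [omega]
   along the equality. *)
- split=> //; split=> //; rewrite deltaE.
  by case: topi => tau0 tauT _ _; exact: affine_closed_omega.
- by apply/seteqP; split=> //; exact: omega_iota_sub.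
Qed.
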